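(* For every complete bipartite graph $G$ and every coloring of the edges of $G$ with $2$ colors, there exist two monochromatic subgraphs $H_1,H_2$ of $G$, each of diameter at most $3$, such that $V(H_1)\cup V(H_2)=V(G)$. Consequently $f(2)=3$, where $f(2)$ denotes the smallest integer $k$ such that for every $2$-edge-coloring of every complete bipartite graph $G$, the set $V(G)$ can be covered by the vertex sets of two monochromatic subgraphs of $G$, each of diameter at most $k$.
   Context: All graphs are finite, and both partite classes of a complete bipartite graph are nonempty. A $2$-coloring of a graph is an arbitrary assignment of one of two colors (red $=1$, blue $=2$) to each edge. A subgraph $H$ (with nonempty vertex set, not necessarily induced) is monochromatic if all its edges have the same color; a single-vertex subgraph is allowed and counts as monochromatic in either color. A graph $H$ has diameter at most $k$ if every two of its vertices are at distance at most $k$ in $H$ itself (so $H$ is connected). The two subgraphs may have the same or different colors and need not be disjoint. *)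

(* Defs.v *)
From mathcomp Require Import all_boot.
Set Implicit Arguments.
Unset Strict Implicit.
Unset Printing Implicit Defensive.

Record sgraph := SGraph {
  vertex :> finType;
  adj : rel vertex;
  adj_sym : symmetric adj;
  adj_irrefl : irreflexive adj
}.

Definition edges (G : sgraph) : {set {set G}} :=
  [set [set p.1; p.2] | p in [pred p : G * G | adj p.1 p.2]].

Definition complete_bipartite (G : sgraph) : Prop :=
  exists A B : {set G},
    [/\ A != set0, B != set0, [disjoint A & B], A :|: B = [set: G]
      & forall x y : G,
          adj x y = (x \in A) && (y \in B) || (x \in B) && (y \in A)].

(* The two booleans are the two colors; values outside [edges G] are never
   used. *)
Definition coloring (G : sgraph) := {set G} -> bool.

Record subgraph (G : sgraph) := Subgraph {
  sub_vertices : {set G};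
  sub_edges : {set {set G}};
  sub_nonempty : sub_vertices != set0;
  sub_edges_in : sub_edges \subset edges G;
  sub_edges_ends : cover sub_edges \subset sub_vertices
}.

Definition monochromatic (G : sgraph) (c : coloring G) (H : subgraph G) : Prop :=
  exists i : bool, forall e : {set G}, e \in sub_edges H -> c e = i.

Definition sub_adj (G : sgraph) (H : subgraph G) : rel G :=
  fun x y => [set x; y] \in sub_edges H.

Definition dist_at_most (G : sgraph) (H : subgraph G) (k : nat) (x y : G) : Prop :=
  exists p : seq G,
    [/\ path (sub_adj H) x p, uniq (x :: p), last x p = y & size p <= k].

Definition diameter_at_most (G : sgraph) (H : subgraph G) (k : nat) : Prop :=
  forall x y : G,
    x \in sub_vertices H -> y \in sub_vertices H -> dist_at_most H k x y.

Definition two_cover_bound (k : nat) : Prop :=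
  forall (G : sgraph) (c : coloring G), complete_bipartite G ->
    exists H1 H2 : subgraph G,
      [/\ monochromatic c H1, monochromatic c H2,
          diameter_at_most H1 k, diameter_at_most H2 k
        & sub_vertices H1 :|: sub_vertices H2 = [set: G]].

(* [f2_is k] reads "f(2) = k". *)
Definition f2_is (k : nat) : Prop :=
  two_cover_bound k /\ forall j : nat, two_cover_bound j -> k <= j.

(* Main.v *)
Require Import Defs.
From mathcomp Require Import all_boot.
Set Implicit Arguments.
Unset Strict Implicit.
Unset Printing Implicit Defensive.

(* Upper bound. A vertex set meeting both classes spans a subgraph of diameter
   at most 3 in colour i as soon as any two of its vertices in the same class
   have a common i-neighbour in it. If x p is an edge of the other colour, then
   {x, p} with its i-neighbours and the double star of x p cover the graph, and
   this works unless x or p is "lone", i.e. has no common i-neighbour with some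
   vertex of its class. Together with covers by two double stars, this leaves
   only colourings in which every vertex of one class A has a complement in A
   (same neighbourhood, colours exchanged), while any two vertices of the other
   class B have common neighbours of both colours. There fix p in B and join h
   and k in B if they have no common red neighbour among the red neighbours of
   p. If this graph is bipartite, its two colour classes give a red and a blue
   subgraph; otherwise a minimal non-bipartite vertex set gives two red ones.

   Lower bound. Colour K_{4,4} so that both colours form an 8-cycle: a subgraph
   of diameter at most 2 is a biclique and has at most 3 vertices. *)

(** * Tight sets and double stars *)

Section TwoColoring.

Context (V : finType) (sd : V -> bool) (cl : rel V).
Context (cl_sym : symmetric cl).

Definition hue (i : bool) : rel V := fun x y => (sd x != sd y) && (cl x y == i).

Definition nbr (i : bool) (x : V) : {set V} := [set y | hue i x y].

Definition meets (i : bool) (S : {set V}) (x y : V) : bool :=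
  [exists z in S, hue i x z && hue i y z].

(* Taking [y = x] shows that no vertex of [S] is isolated; two vertices on
   different sides are then joined by a path of length 3. *)
Definition tight (i : bool) (S : {set V}) : bool :=
  (S != set0) &&
  [forall x in S, forall y in S, (sd x == sd y) ==> meets i S x y].

Definition coverable : bool :=
  [exists i : bool, exists j : bool, exists S : {set V}, exists T : {set V},
    [&& tight i S, tight j T & S :|: T == [set: V]]].

Definition lone (i : bool) (x : V) : bool :=
  [exists y, (sd x == sd y) && ~~ meets i setT x y].

Lemma hue_sym i : symmetric (hue i).
Proof. by move=> x y; rewrite /hue eq_sym cl_sym. Qed.

Lemma hueN i x y : sd x != sd y -> hue (~~ i) x y = ~~ hue i x y.
Proof. by rewrite /hue => ->; case: (cl x y); case: i. Qed.

Lemma hue_side i x y : hue i x y -> sd x != sd y.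
Proof. by case/andP. Qed.

Lemma opp_side x y z : sd x != sd y -> sd x != sd z -> sd y = sd z.
Proof. by case: (sd x); case: (sd y); case: (sd z). Qed.

Lemma meetsP i (S : {set V}) x y :
  reflect (exists z, [/\ z \in S, hue i x z & hue i y z]) (meets i S x y).
Proof.
apply: (iffP exists_inP) => [[z zS /andP[xz yz]]|[z [zS xz yz]]]; exists z => //.
by rewrite xz.
Qed.

Lemma meets_sym i S x y : meets i S x y = meets i S y x.
Proof. by apply/meetsP/meetsP => -[z [? ? ?]]; exists z. Qed.

Lemma tightI i (S : {set V}) s : s \in S ->
  (forall x y, x \in S -> y \in S -> sd x = sd y -> meets i S x y) -> tight i S.
Proof.
move=> sS H; apply/andP; split; first by apply/set0Pn; exists s.
by apply/forall_inP => x xS; apply/forall_inP => y yS; apply/implyP => /eqP; apply: H.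
Qed.

Lemma coverI i j S T :
  tight i S -> tight j T -> (forall v, (v \in S) || (v \in T)) -> coverable.
Proof.
move=> tS tT ST; apply/existsP; exists i; apply/existsP; exists j.
apply/existsP; exists S; apply/existsP; exists T; rewrite tS tT /=.
by apply/eqP/setP => v; rewrite !inE ST.
Qed.

Lemma not_loneP i x :
  reflect (forall y, sd x = sd y -> meets i setT x y) (~~ lone i x).
Proof.
rewrite /lone negb_exists; apply: (iffP forallP) => [H y xy|H y].
  by move: (H y); rewrite xy eqxx negbK.
by rewrite negb_and negbK -implybE; apply/implyP => /eqP/H.
Qed.

Lemma tight_join i p (X Y : {set V}) : p \in Y ->
  (forall x, x \in X -> sd x != sd p) -> (forall y, y \in Y -> sd y = sd p) ->
  {in X &, forall x y, meets i Y x y} -> {in Y &, forall x y, meets i X x y} ->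
  tight i (X :|: Y).
Proof.
move=> pY sX sY mX mY.
have grow (Z : {set V}) u v : Z \subset X :|: Y -> meets i Z u v -> meets i (X :|: Y) u v.
  move=> /subsetP sub /meetsP[z [zZ h1 h2]]; apply/meetsP; exists z.
  by rewrite sub.
apply: (@tightI _ _ p) => [|u v]; first by rewrite inE pY orbT.
rewrite !inE => /orP[uX|uY] /orP[vX|vY] uv.
- by apply: grow (mX u v uX vX); apply: subsetUr.
- by case/negP: (sX u uX); rewrite uv sY.
- by case/negP: (sX v vX); rewrite -uv sY.
- by apply: grow (mY u v uY vY); apply: subsetUl.
Qed.

(** When [hue i x y] holds, [x] and [y] belong to this set: it is the double star of the edge
    [xy]. *)
Definition dstar i x y := nbr i y :|: nbr i x.

Lemma tight_dstar i x y : hue i x y -> tight i (dstar i x y).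
Proof.
move=> xy; have sxy := hue_side xy.
apply: (@tight_join _ y) => [|u|u|u v|u v]; rewrite !inE ?(hue_sym _ y).
- by [].
- by move/hue_side.
- by move=> xu; apply: (opp_side (hue_side xu)).
- by move=> uy vy; apply/meetsP; exists y; rewrite inE.
- by move=> xu xv; apply/meetsP; exists x; rewrite inE !(hue_sym _ _ x) xy.
Qed.

Lemma two_dstars i j x y u v :
  sd x = sd u -> sd y = sd v -> hue i x y -> hue j u v ->
  (forall w, sd w != sd x -> hue i x w || hue j u w) ->
  (forall w, sd w != sd y -> hue i y w || hue j v w) -> coverable.
Proof.
move=> xu yv xy uv Hx Hy.
apply: coverI (tight_dstar xy) (tight_dstar uv) _ => w; rewrite !inE.
have [wx|wx] := eqVneq (sd w) (sd x).
  have wy : sd w != sd y by rewrite wx (hue_side xy).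
  by case/orP: (Hy w wy) => ->; rewrite ?orbT.
by case/orP: (Hx w wx) => ->; rewrite ?orbT.
Qed.

(** * Colourings without a cover *)

Context (side_ex : forall b, exists x, sd x = b).
Context (nc : ~~ coverable).

(** If [z] were an [i]-neighbour of [y] but not of [x], the double stars of [yz] in colour [i] and
    of [xz] in the other colour would cover: a vertex facing [x] and [y] is joined to [x] in colour
    [~~ i] or to [y] in colour [i], and one facing [z] is joined to [z] in some colour. *)
Lemma nbr_antichain i x y :
  sd x = sd y -> nbr i x \subset nbr i y -> nbr i y \subset nbr i x.
Proof.
move=> xy /subsetP sxy; apply/subsetP => z; rewrite !inE => yz.
apply/negPn/negP => nxz; case/negP: nc.
have xz : hue (~~ i) x z by rewrite hueN // xy (hue_side yz).
apply: (two_dstars (esym xy) erefl yz xz) => w sw.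
  have sxw : sd x != sd w by rewrite xy eq_sym.
  rewrite hueN //; case: (boolP (hue i x w)) => [xw|]; last by rewrite orbT.
  by move: (sxy w); rewrite !inE xw => ->.
by rewrite hueN ?orbN // eq_sym.
Qed.

(* The central step: if [x] and [p] are joined in colour [~~ i] and nothing
   separates them in colour [i], the double star of the edge [xp] together
   with the same two vertices and their [i]-neighbourhoods is a cover. *)
Lemma hue_of_not_lone i x p :
  sd x != sd p -> ~~ lone i x -> ~~ lone i p -> hue i x p.
Proof.
move=> sxp /not_loneP nlx /not_loneP nlp.
apply/negPn/negP => nxp; have xp : hue (~~ i) x p by rewrite hueN.
have mx a : sd x = sd a -> exists2 z, hue i x z & hue i a z.
  by move=> /nlx/meetsP[z [_ h1 h2]]; exists z.
have mp a : sd p = sd a -> exists2 z, hue i p z & hue i a z.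
  by move=> /nlp/meetsP[z [_ h1 h2]]; exists z.
have px : hue (~~ i) p x by rewrite hue_sym.
(* Two [i]-neighbours of [t] meet in [t]; a pair containing [s] meets in [nbr i s] since [s] is not
   lone. *)
have half s t : hue (~~ i) s t ->
    (forall a, sd s = sd a -> exists2 z, hue i s z & hue i a z) ->
    {in s |: nbr i t &, forall u v, meets i (t |: nbr i s) u v}.
  move=> st ms u v; rewrite !inE => hu hv; apply/meetsP.
  have same w : hue i t w -> sd s = sd w.
    by move/hue_side; apply: opp_side; rewrite eq_sym (hue_side st).
  case/orP: hu => [/eqP->|hu].
    have [z h1 h2] : exists2 z, hue i s z & hue i v z.
      by apply: ms; case/orP: hv => [/eqP->|/same].
    by exists z; rewrite !inE h1 orbT.
  case/orP: hv => [/eqP->|hv].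
    by have [z h1 h2] := ms u (same u hu); exists z; rewrite !inE h1 orbT.
  by exists t; rewrite !inE eqxx !(hue_sym _ _ t).
case/negP: nc.
apply: (coverI (S := (x |: nbr i p) :|: (p |: nbr i x)) (i := i) _ (tight_dstar xp)).
  apply: (@tight_join _ p); rewrite ?setU11 //.
  - by move=> u; rewrite !inE => /orP[/eqP->//|/hue_side]; rewrite eq_sym.
  - move=> u; rewrite !inE => /orP[/eqP->//|/hue_side] xu.
    by apply: (opp_side xu).
  - exact: half xp mx.
  - exact: half px mp.
move=> w; rewrite !inE; have [wx|wx] := eqVneq (sd w) (sd x).
  by rewrite (hueN _ (x := p)) ?wx 1?eq_sym //; case: (hue i p w); rewrite ?orbT.
by rewrite (hueN _ (x := x)) 1?eq_sym //; case: (hue i x w); rewrite ?orbT.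
Qed.

(** If [x, x'] and [y, y'] are pairs without common [i]-neighbours, every vertex facing a pair sees
    one of its members in colour [~~ i]. Two disjoint edges of that colour between the pairs then
    give double stars that cover. *)
Lemma lone_one_side i x y : sd x != sd y -> lone i x -> ~~ lone i y.
Proof.
move=> sxy /existsP[x' /andP[/eqP xx' nx]]; apply/negP => /existsP[y' /andP[/eqP yy' ny]].
have colx w : sd w != sd x -> hue (~~ i) x w || hue (~~ i) x' w.
  move=> sw; rewrite !hueN -?xx' 1?eq_sym // -negb_and; apply: contra nx => /andP[h1 h2].
  by apply/meetsP; exists w.
have coly w : sd w != sd y -> hue (~~ i) y w || hue (~~ i) y' w.
  move=> sw; rewrite !hueN -?yy' 1?eq_sym // -negb_and; apply: contra ny => /andP[h1 h2].
  by apply/meetsP; exists w.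
(* A bipartite graph on 2+2 vertices without isolated vertices has a perfect matching. *)
have cov : (hue (~~ i) x y && hue (~~ i) x' y') ||
    (hue (~~ i) x y' && hue (~~ i) x' y).
  have := colx y; rewrite eq_sym sxy => /(_ isT).
  have := colx y'; rewrite eq_sym -yy' sxy => /(_ isT).
  have := coly x sxy; have := coly x'; rewrite -xx' sxy => /(_ isT).
  rewrite !(hue_sym _ y) !(hue_sym _ y').
  by do 4! case: (hue _ _ _).
case/negP: nc; case/orP: cov => /andP[h1 h2].
  exact: (two_dstars xx' yy' h1 h2 colx coly).
apply: (two_dstars xx' (esym yy') h1 h2 colx) => w; rewrite -yy' => /coly.
by rewrite orbC.
Qed.

Lemma lone_ex i : exists x, lone i x.
Proof.
apply/existsP; apply: contraT => /existsPn nl.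
have [x _] := side_ex true.
have tS : tight i [set: V].
  by apply: (@tightI _ _ x) => // u v _ _; apply/not_loneP/nl.
by case/negP: nc; apply: (coverI tS tS) => v; rewrite inE.
Qed.

(* A non-lone vertex facing a side without lone vertices sees all of it. *)
Lemma lone_all i x y : lone i x -> sd x = sd y -> lone i y.
Proof.
move=> lx xy; apply: contraT => nly.
have full w : sd w != sd y -> hue i y w.
  by move=> sw; apply: hue_of_not_lone; rewrite 1?eq_sym // (lone_one_side _ lx) // xy eq_sym.
(* The neighbourhood of [y] is the whole opposite side, so by the antichain property every vertex
   beside [y] has the same one. *)
have all u w : sd u = sd y -> sd w != sd y -> hue i u w.
  move=> uy wy; have := @nbr_antichain i u y uy.
  have -> : nbr i u \subset nbr i y.
    by apply/subsetP => z; rewrite !inE => uz; apply: full; rewrite -uy eq_sym (hue_side uz).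
  by move=> /(_ isT)/subsetP/(_ w); rewrite !inE => H; apply/H/full.
case/existsP: lx => x' /andP[/eqP xx' /negP[]].
have [w yw] := side_ex (~~ sd y).
have wy : sd w != sd y by rewrite yw; case: (sd y).
by apply/meetsP; exists w; split=> //; apply: all; rewrite -?xx'.
Qed.

(** Suppose the sides differ, and let [y, y'] have no common blue neighbour. They have a common red
    neighbour [a], which is lone in red because [x] is. If [a, a'] have no common red neighbour,
    then [a'] is a common blue neighbour of [y, y']. *)
Lemma lone_same_side x y : lone true x -> lone false y -> sd x = sd y.
Proof.
move=> lx ly; apply/eqP/negPn/negP => sxy.
have nly : ~~ lone true y by apply: lone_one_side lx.
case/existsP: (ly) => y' /andP[/eqP yy' ny].
case/meetsP: (not_loneP _ _ nly _ yy') => a [_ ya y'a].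
have sxa : sd x = sd a.
  by apply: (opp_side (x := y)); rewrite ?(hue_side ya) // eq_sym.
case/existsP: (lone_all lx sxa) => a' /andP[/eqP aa' na].
have sya : sd y != sd a' by rewrite -aa' (hue_side ya).
have out z : hue true z a -> sd z = sd y -> hue false z a'.
  move=> za zy; rewrite -[false]/(~~ true) hueN ?zy //; apply: contra na => za'.
  by apply/meetsP; exists z; rewrite !(hue_sym _ _ z).
by case/negP: ny; apply/meetsP; exists a'; rewrite !out.
Qed.

Lemma complements : exists p,
  (forall i h k, sd h = sd p -> sd k = sd p -> meets i setT h k) /\
  (forall a, sd a != sd p -> exists a',
     forall i h, sd h = sd p -> hue (~~ i) a' h = hue i a h).
Proof.
have [x lx] := lone_ex true; have [y ly] := lone_ex false.
have xy := lone_same_side lx ly.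
have lon i a : sd a = sd x -> lone i a.
  by move=> ax; case: i; [apply: lone_all lx _|apply: lone_all ly _]; rewrite -?xy.
have [p px] := side_ex (~~ sd x); exists p; split.
  move=> i h k hp kp; apply: contraT => nhk.
  have nl : ~~ lone i h.
    by apply: lone_one_side (lon i x erefl); rewrite hp px; case: (sd x).
  by case/negP: nl; apply/existsP; exists k; rewrite hp kp eqxx.
move=> a; rewrite px => sap; have ax : sd a = sd x by move: sap; case: (sd a); case: (sd x).
case/existsP: (lon true a ax) => a' /andP[/eqP aa' na].
case/existsP: (lon false a ax) => b /andP[/eqP ab nb].
have in1 z : hue true a' z -> ~~ hue true a z.
  by move=> h1; apply: contra na => h2; apply/meetsP; exists z.
have in2 z : sd a != sd z -> ~~ hue true a z -> hue true b z.
  move=> az; rewrite -hueN // => h1.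
  apply/negPn/negP; rewrite -hueN -?ab // => h2; case/negP: nb.
  by apply/meetsP; exists z.
(* The red neighbourhood of [a'] lies in the complement of that of [a], which lies in that of [b];
   the antichain property forces equality throughout. *)
have sub : nbr true a' \subset nbr true b.
  by apply/subsetP => z; rewrite !inE => h1; apply: in2 (in1 _ h1); rewrite aa' (hue_side h1).
have /subsetP sub' := nbr_antichain (etrans (esym aa') ab) sub.
exists a' => i h hp.
have sa : sd a != sd h by rewrite hp ax; case: (sd x).
have compl : hue true a' h = ~~ hue true a h.
  apply/idP/idP => [/in1//|n].
  by have := sub' h; rewrite !inE; apply; apply: in2.
have sa' : sd a' != sd h by rewrite -aa'.
have hF u : sd u != sd h -> hue false u h = ~~ hue true u h := @hueN true u h.
by case: i; rewrite /= !hF // compl ?negbK.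
Qed.

(** * Complemented colourings *)

(* For [h], [k] on the side of [p], call [h], [k] clashing if they have no
   common [true]-neighbour in [nbr true p].  Complements turn [true]-neighbours
   in [nbr true p] into [false]-neighbours in [nbr false p], so a proper
   2-colouring of the clash graph gives a cover by one subgraph of each colour.
   A minimal set [S] that is not 2-colourable yields one in colour [true]: any
   [a], [b] in [nbr false p] have a common neighbour in [S], for otherwise
   [h |-> hue true a h] would be a proper 2-colouring of [S].  The second
   subgraph is obtained by extending [S] to a maximal set in which no two
   vertices are apart (have no common [true]-neighbour in [nbr false p]): the
   vertices left out pairwise do not clash. *)
Lemma complemented_coverable p :
  (forall i h k, sd h = sd p -> sd k = sd p -> meets i setT h k) ->
  (forall a, sd a != sd p -> exists a',
     forall i h, sd h = sd p -> hue (~~ i) a' h = hue i a h) ->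
  coverable.
Proof.
move=> common compl.
pose B := [set h | sd h == sd p].
have sN i a : a \in nbr i p -> sd a != sd p by rewrite inE => /hue_side; rewrite eq_sym.
have swap i j h k : h \in B -> k \in B ->
    meets i (nbr j p) h k -> meets (~~ i) (nbr (~~ j) p) h k.
  rewrite !inE => /eqP hB /eqP kB /meetsP[a [aN ha ka]].
  have [a' ca] := compl a (sN _ _ aN); apply/meetsP; exists a'.
  by move: aN; rewrite !inE !(hue_sym _ _ a') !ca // !(hue_sym _ a).
(* [p] is the common neighbour of any two vertices of [nbr j p], hence [p \in X]. *)
have two j (X : {set V}) : X \subset B -> p \in X ->
    {in X &, forall h k, meets j (nbr j p) h k} -> tight j (nbr j p :|: X).
  move=> /subsetP sX pX mX; apply: (@tight_join _ p) => //.
  - exact: sN.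
  - by move=> y /sX; rewrite inE => /eqP.
  - move=> u v; rewrite !inE => uN vN; apply/meetsP; exists p.
    by rewrite !(hue_sym _ _ p).
have sides w : (w \in nbr true p) || (w \in nbr false p) || (w \in B).
  rewrite !inE; have [_|sw] := eqVneq (sd w) (sd p); first by rewrite orbT.
  by rewrite (@hueN true p w) 1?eq_sym // orbN.
have pB : p \in B by rewrite inE.
pose clash h k := ~~ meets true (nbr true p) h k.
pose apart h k := ~~ meets true (nbr false p) h k.
have clashC h k : clash h k = clash k h by rewrite /clash meets_sym.
have commonB h k : h \in B -> k \in B -> ~~ (clash h k && apart h k).
  rewrite !inE => /eqP hB /eqP kB; have /meetsP[z [_ hz kz]] := common true h k hB kB.
  have szp : sd p != sd z by rewrite -hB (hue_side hz).
  rewrite -negb_or negbK; case: (boolP (hue true p z)) => pz.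
    by apply/orP; left; apply/meetsP; exists z; rewrite inE.
  by apply/orP; right; apply/meetsP; exists z; rewrite inE (@hueN true).
have meet_p h : h \in B -> meets true (nbr true p) p h.
  rewrite inE => /eqP hB; have /meetsP[z [_ pz hz]] := common true p h erefl hB.
  by apply/meetsP; exists z; rewrite inE.
have clashhh h : h \in B -> ~~ clash h h.
  move=> /meet_p/meetsP[z [zN _ hz]]; rewrite negbK.
  by apply/meetsP; exists z.
pose proper (f : {ffun V -> bool}) (S : {set V}) :=
  [forall h in S, forall k in S, clash h k ==> (f h != f k)].
have properP (f : {ffun V -> bool}) (S : {set V}) :
    reflect {in S &, forall h k, clash h k -> f h != f k} (proper f S).
  apply: (iffP forall_inP) => [H h k hS kS|H h hS].
    by move/forall_inP: (H h hS) => /(_ k kS)/implyP.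
  by apply/forall_inP => k kS; apply/implyP/H.
have avoid u h k : u \in nbr false p -> h \in B -> k \in B ->
    ~~ hue true u h -> ~~ hue true u k -> ~~ clash h k.
  move=> uN hB kB uh uk; rewrite negbK; apply: (@swap false false) => //.
  apply/meetsP; exists u; rewrite uN !(hue_sym _ _ u) !(@hueN true) ?uh ?uk //.
    by move: kB (sN _ _ uN); rewrite inE => /eqP->.
  by move: hB (sN _ _ uN); rewrite inE => /eqP->.
case: (boolP [exists f, proper f B]) => [/existsP[f /properP fB]|nB].
  (* [p] clashes with no vertex of [B], so it can join both colour classes. *)
  have half j : {in p |: [set h in B | f h == j] &, forall h k, meets true (nbr true p) h k}.
    move=> h k /setU1P[->|hS] /setU1P[->|kS]; first exact: meet_p.
    - by apply: meet_p; case/setIdP: kS.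
    - by rewrite meets_sym; apply: meet_p; case/setIdP: hS.
    case/setIdP: hS => hB /eqP fh; case/setIdP: kS => kB /eqP fk.
    by apply: contraT => /(fB h k hB kB); rewrite fh fk eqxx.
  have subB j : p |: [set h in B | f h == j] \subset B.
    by rewrite subUset sub1set pB; apply/subsetP => h /setIdP[].
  have t1 := two true _ (subB true) (setU11 _ _) (half true).
  have t2 : tight false (nbr false p :|: (p |: [set h in B | f h == false])).
    apply: two; rewrite ?setU11 // => h k hS kS.
    have /subsetP sB := subB false.
    exact: (@swap true true) (sB _ hS) (sB _ kS) (half false h k hS kS).
  apply: (coverI t1 t2) => w; case/orP: (sides w) => [/orP[wN|wN]|wB].
  - by rewrite inE wN.
  - by rewrite orbC inE wN.
  have : w \in [set h in B | f h == f w] by apply/setIdP.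
  by case: (f w) => wf; [|rewrite orbC]; rewrite !in_setU wf !orbT.
pose bad (S : {set V}) := ~~ [exists f, proper f S].
have [S /minsetP[badS minS] SB] := @minset_exists _ bad B nB.
have sSB h : h \in S -> h \in B by move/subsetP: SB; apply.
have extend h f : h \in S -> proper f (S :\ h) -> forall b,
    (forall x, x \in S -> x != h -> clash h x -> f x != b) -> False.
  move=> hS /properP fS b fb; case/existsP: badS.
  exists [ffun x => if x == h then b else f x]; apply/properP => x y xS yS xy.
  rewrite !ffunE; have [xh|xh] := eqVneq x h; have [yh|yh] := eqVneq y h.
  - by move: xy; rewrite xh yh (negPf (clashhh _ (sSB h hS))).
  - by rewrite eq_sym; apply: fb => //; rewrite -xh.
  - by apply: fb => //; rewrite clashC -yh.
  - by apply: fS; rewrite ?in_setD1 ?xh ?yh.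
(* If [h], [k] in [S] were apart, every vertex clashing with [h] would clash
   with every vertex clashing with [k], so a 2-colouring of [S :\ h] would be
   constant on the former and extend to [h]. *)
have apart_free : {in S &, forall h k, ~~ apart h k}.
  move=> h k hS kS; apply/negP => hk.
  have [hB kB] := (sSB h hS, sSB k kS).
  have nchk : ~~ clash h k by have := commonB h k hB kB; rewrite hk andbT.
  have colour u : u \in S -> exists f, proper f (S :\ u).
    move=> uS; apply/existsP; apply: contraT => /minS.
    by rewrite subD1set => /(_ isT) /setP/(_ u); rewrite setD11 uS.
  have [y yS cky] : exists2 y, y \in S & clash k y.
    apply/exists_inP; apply: contraT => /exists_inPn nok.
    have [f pf] := colour k kS.
    case: (extend k f kS pf true) => x xS _ /idP; rewrite (negPf (nok x xS)).
    by [].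
  have yh : y != h by apply: contraNneq nchk => <-; rewrite clashC.
  have [f pf] := colour h hS; apply: (extend h f hS pf (f y)) => x xS xh chx.
  move/properP: pf; apply; rewrite ?in_setD1 ?xh ?yh //.
  (* The clashes make [a] blue to [h] and [k]; its complement is then red to both and lies in
     [nbr false p], so [h] and [k] are not apart. *)
  apply/negP => /meetsP[a [aN xa ya]].
  have [a' ca] := compl a (sN _ _ aN).
  have far u v : u \in B -> v \in S -> clash u v -> hue true v a -> hue true u a'.
    rewrite inE => /eqP uB vS cuv va; rewrite hue_sym (ca false u uB).
    rewrite (@hueN true) ?uB ?(sN _ _ aN) //; apply: contra cuv => au.
    by apply/meetsP; exists a; rewrite -(hue_sym _ a).
  case/negP: hk; apply/meetsP; exists a'.
  rewrite (far h x) // (far k y) // inE hue_sym (ca true p erefl) hue_sym.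
  by move: aN; rewrite inE.
pose free (M : {set V}) :=
  (M \subset B) && [forall h in M, forall k in M, ~~ apart h k].
have freeP (M : {set V}) : reflect (M \subset B /\ {in M &, forall h k, ~~ apart h k}) (free M).
  apply: (iffP andP) => -[MB H]; split=> //.
    by move=> h k hM kM; move/forall_inP: H => /(_ h hM)/forall_inP/(_ k kM).
  by apply/forall_inP => h hM; apply/forall_inP => k kM; apply: H.
have [M /maxsetP[/freeP[MB freeM] maxM] SM] :=
  @maxset_exists _ free S (introT (freeP S) (conj SB apart_free)).
have [s sS] : exists s, s \in S.
  apply/set0Pn; apply: contraNneq badS => ->; apply/existsP.
  by exists [ffun=> true]; apply/properP => h k; rewrite inE.
have apartC h k : apart h k = apart k h by rewrite /apart meets_sym.
(* [p] has no red neighbour in [nbr false p], so it is apart from itself. *)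
have pM : p \notin M.
  apply/negP => pM; have := freeM p p pM pM; rewrite negbK => /meetsP[z [+ pz _]].
  by move: pz; rewrite inE /hue => /andP[_ /eqP->]; rewrite andbF.
have apartM h : h \in B -> h \notin M -> exists2 c, c \in M & apart h c.
  move=> hB hM; apply/exists_inP; apply: contraT => /exists_inPn nd.
  have dd : ~~ apart h h.
    apply: contra (nd s (subsetP SM _ sS)) => hh.
    apply: contra hh => /meetsP[z [zN hz _]].
    by apply/meetsP; exists z.
  case/negP: (hM); have <- : h |: M = M; last by rewrite setU11.
  apply: maxM; last exact: subsetUr.
  apply/freeP; split; first by rewrite subUset sub1set hB.
  move=> u v /setU1P[->|uM] /setU1P[->|vM]; [exact: dd|exact: nd| |exact: freeM].
  by rewrite apartC; apply: nd.
(* By maximality [h] and [k] are apart from some [c] and [d] in [M]. A common red neighbour of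
   [c, d] in [nbr false p] is blue to [h, k], and its complement is the vertex sought. *)
have mout : {in B :\: M &, forall h k, meets true (nbr true p) h k}.
  move=> h k; rewrite !in_setD => /andP[hM hB] /andP[kM kB].
  have [c cM hc] := apartM h hB hM; have [d dM kd] := apartM k kB kM.
  have := freeM c d cM dM; rewrite negbK => /meetsP[a [aN ca da]].
  have [a' cma] := compl a (sN _ _ aN).
  have far u v : u \in B -> apart u v -> hue true v a -> hue true u a'.
    rewrite inE => /eqP uB duv va; rewrite hue_sym (cma false u uB).
    rewrite (@hueN true) ?uB ?(sN _ _ aN) //; apply: contra duv => au.
    by apply/meetsP; exists a; rewrite -(hue_sym _ a).
  apply/meetsP; exists a'; rewrite (far h c) // (far k d) //.
  by move: aN; rewrite !inE !(hue_sym _ p) (cma false p erefl).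
have tout := two true (B :\: M) (subsetDl _ _) _ mout.
have t1 : tight true (nbr true p :|: B :\: M) by apply: tout; rewrite in_setD pM.
have t2 : tight true (nbr false p :|: M).
  apply: (tight_join (subsetP SM _ sS)).
  - move=> x xN; have := subsetP MB _ (subsetP SM _ sS); rewrite inE => /eqP->.
    exact: sN xN.
  - move=> y /(subsetP MB); have := subsetP MB _ (subsetP SM _ sS).
    by rewrite !inE => /eqP-> /eqP->.
  - move=> a b aN bN; apply: contraT => nab; case/existsP: badS.
    have off h : h \in S -> hue true a h -> ~~ hue true b h.
      move=> hS ah; apply: contra nab => bh; apply/meetsP; exists h.
      by rewrite (subsetP SM).
    exists [ffun h => hue true a h]; apply/properP => h k hS kS; rewrite !ffunE.
    apply: contraTneq => ahk; have [hB kB] := (sSB h hS, sSB k kS).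
    case ak: (hue true a k); last by apply: (avoid a); rewrite ?ahk ?ak.
    by apply: (avoid b); rewrite ?off ?ahk.
  by move=> h k hM kM; rewrite -[meets _ _ _ _]negbK freeM.
apply: (coverI t1 t2) => w; case/orP: (sides w) => [/orP[wN|wN]|wB].
- by rewrite inE wN.
- by rewrite orbC inE wN.
by rewrite !in_setU in_setD wB andbT; case: (w \in M); rewrite !orbT.
Qed.

End TwoColoring.

(** * The upper bound for graphs *)

Lemma two_coloring_coverable (V : finType) (sd : V -> bool) (cl : rel V) :
  symmetric cl -> (forall b, exists x, sd x = b) -> coverable sd cl.
Proof.
move=> cl_sym side_ex; apply: contraT => nc.
have [p [common compl]] := complements cl_sym side_ex nc.
by case/negP: nc; apply: complemented_coverable common compl.
Qed.

Lemma dist_at_most_path (G : sgraph) (H : subgraph G) k (x : G) p :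
  path (sub_adj H) x p -> size p <= k -> dist_at_most H k x (last x p).
Proof.
move=> px pk; case/shortenP: px => p' px' ux' sub; exists p'; split=> //.
by apply: leq_trans pk; apply: uniq_leq_size => //; case/andP: ux'.
Qed.

Lemma tight_subgraph (G : sgraph) (c : coloring G) (sd : G -> bool) i (S : {set G}) :
  (forall x y, sd x != sd y -> adj x y) ->
  tight sd (fun x y => c [set x; y]) i S ->
  exists H : subgraph G,
    [/\ sub_vertices H = S, monochromatic c H & diameter_at_most H 3].
Proof.
move=> sd_adj /andP[S0 /forall_inP tS].
set hueS := hue sd (fun x y => c [set x; y]) i.
pose E := [set [set p.1; p.2] | p in [pred p : G * G |
             [&& p.1 \in S, p.2 \in S & hueS p.1 p.2]]].
have Ein : E \subset edges G.
  apply/subsetP => e /imsetP[p]; rewrite inE => /and3P[_ _ /andP[sp _]] ->.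
  by apply/imsetP; exists p; rewrite // inE sd_adj.
have Eends : cover E \subset S.
  apply/bigcupsP => e /imsetP[p]; rewrite inE => /and3P[p1 p2 _] ->.
  by rewrite subUset !sub1set p1.
have mem x y : x \in S -> y \in S -> hueS x y -> [set x; y] \in E.
  by move=> xS yS xy; apply/imsetP; exists (x, y) => //; rewrite inE xS yS.
have common x y : x \in S -> y \in S -> sd x = sd y ->
    exists z, [/\ z \in S, sd x != sd z, [set x; z] \in E & [set z; y] \in E].
  move=> xS yS xy; move/forall_inP: (tS x xS) => /(_ y yS); rewrite xy eqxx.
  case/meetsP=> z [zS xz yz]; exists z; split=> //; [exact: hue_side yz|exact: mem|].
  by rewrite setUC; apply: mem.
exists (Subgraph S0 Ein Eends); split=> //=.
  exists i => e /imsetP[p]; rewrite inE => /and3P[_ _ /andP[_ /eqP cp]] ->.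
  exact: cp.
move=> x y /= xS yS; have [xy|xy] := eqVneq (sd x) (sd y).
  have [z [_ _ xz zy]] := common x y xS yS xy.
  by apply: (@dist_at_most_path _ _ 3 x [:: z; y]); rewrite //= /sub_adj /= xz zy.
have [z [zS sxz xz _]] := common x x xS xS erefl.
have zy : sd z = sd y := opp_side sxz xy.
have [w [_ _ zw wy]] := common z y zS yS zy.
by apply: (@dist_at_most_path _ _ 3 x [:: z; w; y]); rewrite //= /sub_adj /= xz zw wy.
Qed.

Lemma two_cover_bound3 : two_cover_bound 3.
Proof.
move=> G c [A [B [/set0Pn[a aA] /set0Pn[b bB] dAB AB adjE]]].
pose sd x := x \in A.
have inB x : (x \in B) = ~~ sd x.
  have := in_setT x; rewrite -AB inE /sd; case: (boolP (x \in A)) => //= xA _.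
  exact: (disjointFr dAB xA).
have sd_adj x y : sd x != sd y -> adj x y.
  by rewrite adjE !inB /sd; case: (x \in A); case: (y \in A).
have cl_sym : symmetric (fun x y : G => c [set x; y]) by move=> x y; rewrite setUC.
have side_ex s : exists x, sd x = s.
  by case: s; [exists a|exists b; apply/negbTE; rewrite -inB].
have := two_coloring_coverable cl_sym side_ex.
case/existsP=> i /existsP[j /existsP[S /existsP[T /and3P[tS tT /eqP ST]]]].
have [H1 [V1 m1 d1]] := tight_subgraph sd_adj tS.
have [H2 [V2 m2 d2]] := tight_subgraph sd_adj tT.
by exists H1, H2; split=> //; rewrite V1 V2.
Qed.

(** * The lower bound *)

Definition K44_adj : rel (bool * 'I_4) := fun x y => x.1 != y.1.

Lemma K44_adj_sym : symmetric K44_adj.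
Proof. by move=> x y; rewrite /K44_adj eq_sym. Qed.

Lemma K44_adj_irrefl : irreflexive K44_adj.
Proof. by move=> x; rewrite /K44_adj eqxx. Qed.

Definition K44 := SGraph K44_adj_sym K44_adj_irrefl.

Lemma K44_complete_bipartite : complete_bipartite K44.
Proof.
exists [set x : K44 | x.1], [set x : K44 | ~~ x.1]; split.
- by apply/set0Pn; exists (true, ord0); rewrite inE.
- by apply/set0Pn; exists (false, ord0); rewrite inE.
- by rewrite -setI_eq0; apply/eqP/setP => x; rewrite !inE andbN.
- by apply/setP => x; rewrite !inE orbN.
by move=> [[] x] [[] y]; rewrite !inE.
Qed.

(* Both colour classes of this colouring of [K44] are 8-cycles. *)
Definition cyc (a b : 'I_4) : bool := (b == a :> nat) || (b == a.+1 %% 4 :> nat).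

Definition K44_coloring : coloring K44 :=
  fun e => [exists a, exists b, cyc a b && (e == [set (true, a); (false, b)])].

Lemma K44_coloringE a b : K44_coloring [set (true, a); (false, b)] = cyc a b.
Proof.
apply/existsP/idP => [[a' /existsP[b' /andP[ab /eqP /setP e]]]|ab]; last first.
  by exists a; apply/existsP; exists b; rewrite ab eqxx.
have := e (true, a); have := e (false, b).
by rewrite !inE !xpair_eqE !eqxx /= !orbF => /esym/eqP -> /esym/eqP ->.
Qed.

(** The last two hypotheses keep what connectedness gives; without them a whole side, with four
    vertices, would qualify. The proof checks all subsets by computation. *)
Lemma biclique_small i (x y : 'I_4 -> bool) :
  (forall a b, x a -> y b -> cyc a b = i) ->
  (forall a a', x a -> x a' -> a != a' -> exists b, y b) ->
  (forall b b', y b -> y b' -> b != b' -> exists a, x a) ->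
  \sum_(a < 4) x a + \sum_(b < 4) y b <= 3.
Proof.
move=> xy xx yy.
pose a0 := @Ordinal 4 0 isT; pose a1 := @Ordinal 4 1 isT.
pose a2 := @Ordinal 4 2 isT; pose a3 := @Ordinal 4 3 isT.
have sum4 (f : 'I_4 -> bool) : \sum_(a < 4) f a = f a0 + f a1 + f a2 + f a3.
  rewrite !big_ord_recl big_ord0 addn0 !addnA.
  by congr (nat_of_bool (f _) + nat_of_bool (f _) + nat_of_bool (f _) +
    nat_of_bool (f _)); apply: val_inj.
have some (f : 'I_4 -> bool) : (exists a, f a) -> [|| f a0, f a1, f a2 | f a3].
  case=> -[[|[|[|[|//]]]] lt] fa; move: fa.
  - by rewrite (_ : Ordinal lt = a0) => [->//|]; apply: val_inj.
  - by rewrite (_ : Ordinal lt = a1) => [->|]; rewrite ?orbT //; apply: val_inj.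
  - by rewrite (_ : Ordinal lt = a2) => [->|]; rewrite ?orbT //; apply: val_inj.
  - by rewrite (_ : Ordinal lt = a3) => [->|]; rewrite ?orbT //; apply: val_inj.
pose os := [:: a0; a1; a2; a3].
have hxy : all (fun a => all (fun b => x a && y b ==> (cyc a b == i)) os) os.
  by apply/allP => a _; apply/allP => b _; apply/implyP => /andP[xa yb]; rewrite xy.
have hxx : all (fun a => all (fun a' => [&& a != a', x a & x a'] ==> has y os) os) os.
  apply/allP => a _; apply/allP => a' _; apply/implyP => /and3P[aa' xa xa'].
  by rewrite /= orbF; apply/some/(xx a a').
have hyy : all (fun b => all (fun b' => [&& b != b', y b & y b'] ==> has x os) os) os.
  apply/allP => a _; apply/allP => a' _; apply/implyP => /and3P[aa' xa xa'].
  by rewrite /= orbF; apply/some/(yy a a').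
rewrite !sum4; move: hxy hxx hyy; rewrite /cyc /=.
move: (x a0) (x a1) (x a2) (x a3) (y a0) (y a1) (y a2) (y a3).
by case: i {xy} => -[] [] [] [] [] [] [] [].
Qed.

Lemma diameter2_card (H : subgraph K44) :
  monochromatic K44_coloring H -> diameter_at_most H 2 -> #|sub_vertices H| <= 3.
Proof.
move=> [i mono] diam.
have adjP u v : sub_adj H u v -> u.1 != v.1 /\ v \in sub_vertices H.
  move=> uv; split; last first.
    apply: (subsetP (sub_edges_ends H)); apply/bigcupP; exists [set u; v] => //.
    by rewrite !inE eqxx orbT.
  move/imsetP: (subsetP (sub_edges_in H) _ uv) => [[p q]]; rewrite inE /= => pq e.
  apply: contraNneq pq => uv1.
  have fstE z : z \in [set u; v] -> z.1 = u.1 by rewrite !inE => /orP[] /eqP->.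
  by rewrite /K44_adj /= (fstE p) ?(fstE q) // e !inE eqxx ?orbT.
have -> : #|sub_vertices H| =
    \sum_(a < 4) ((true, a) \in sub_vertices H) +
    \sum_(b < 4) ((false, b) \in sub_vertices H).
  rewrite -sum1_card big_mkcond /=.
  transitivity (\sum_s \sum_(a < 4) ((s, a) \in sub_vertices H : nat)).
    rewrite pair_big /=; apply: eq_bigr => -[s a] _ /=.
    by case: (_ \in _).
  by rewrite big_bool.
have step (s : bool) (a a' : 'I_4) :
    (s, a) \in sub_vertices H -> (s, a') \in sub_vertices H -> a != a' ->
    exists b, (~~ s, b) \in sub_vertices H.
  move=> aH aH' aa'; have [[|[t b] p] [/= pp _ lp _]] := diam _ _ aH aH'.
    by case: lp aa' => ->; rewrite eqxx.
  case/andP: pp => /adjP[/= st tH] _; exists b.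
  by move: st tH; case: (s); case: (t).
apply: (@biclique_small i) => [a b aH bH|a a'|b b']; [|exact: step|exact: step].
(* A path between opposite sides has odd length, so length at most 2 means a single edge. *)
have [[|u [|v [|w p]]] [/= pp _ lp sp]] := diam _ _ aH bH => //.
  by rewrite -K44_coloringE; apply: mono; rewrite -lp; case/andP: pp.
case/and3P: pp => /adjP[au _] /adjP[uv _] _.
by move: au uv; rewrite lp /=; case: (u.1).
Qed.

Lemma two_cover_bound_ge3 k : two_cover_bound k -> 3 <= k.
Proof.
move=> bound; rewrite leqNgt; apply/negP => k2.
have [H1 [H2 [m1 m2 d1 d2 cov]]] := bound K44 K44_coloring K44_complete_bipartite.
have weaken (H : subgraph K44) : diameter_at_most H k -> diameter_at_most H 2.
  move=> d x y xH yH; have [p [? ? ? sp]] := d x y xH yH; exists p; split=> //.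
  exact: leq_trans sp k2.
have c1 := diameter2_card m1 (weaken _ d1); have c2 := diameter2_card m2 (weaken _ d2).
have : #|[set: K44]| <= 6.
  rewrite -cov; apply: leq_trans (leq_add c1 c2).
  by rewrite cardsU leq_subr.
by rewrite cardsT card_prod card_bool card_ord.
Qed.

Theorem theorem1p3 :
  (forall (G : sgraph) (c : coloring G), complete_bipartite G ->
    exists H1 H2 : subgraph G,
      [/\ monochromatic c H1, monochromatic c H2,
          diameter_at_most H1 3, diameter_at_most H2 3
        & sub_vertices H1 :|: sub_vertices H2 = [set: G]])
  /\ f2_is 3.
Proof.
split; first exact: two_cover_bound3.
by split; [exact: two_cover_bound3|exact: two_cover_bound_ge3].
Qed.
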